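(* Let $\bar x\in\mathcal R=\{x\in S:\ G(x)\subseteq C\}$ be a local weakly efficient solution to the vector optimization problem of minimizing $f$ (with respect to the cone $K$) over $\mathcal R$. Suppose that: (i) $f$ is $K$-Lipschitz near $\bar x$, with constant $\ell_f>0$ and vector $e\in\mathrm{int}\,K\cap\mathbb B$, and $f$ is directionally differentiable at $\bar x$; (ii) $G$ is lower semicontinuous in a neighbourhood of $\bar x$ and metrically $C$-increasing around $\bar x$, relative to $S$; (iii) $\widehat\partial^+\nu_{G,C}(\bar x)\neq\varnothing$. Then for any $\alpha\in(1,\mathrm{inc}_C(G;S;\bar x))$, any $\ell\ge\ell_f$ and any $x^*\in\widehat\partial^+\nu_{G,C}(\bar x)$ one has $$f'(\bar x;v)+\frac{\ell}{\alpha-1}\langle x^*,v\rangle e\notin-\mathrm{int}\,K,\qquad\forall v\in \mathrm I(S;\bar x).$$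
   Context: Setting: $\mathbb X,\mathbb Y,\mathbb Z$ are real Banach spaces; $K\subseteq\mathbb Y$ is a (proper) convex cone with $\mathrm{int}\,K\neq\varnothing$, inducing the partial order $y_1\le_K y_2\iff y_2-y_1\in K$; $C\subseteq\mathbb Z$ is a proper closed convex cone, $C\neq\{\mathbf 0\}$; $S\subseteq\mathbb X$ is nonempty and closed; $f:\mathbb X\to\mathbb Y$ is a mapping; $G:\mathbb X\rightrightarrows\mathbb Z$ is a set-valued mapping with $G(x)\neq\varnothing$ for every $x\in\mathbb X$. $\mathrm B(x,r)$ is the closed ball with center $x$ and radius $r$, and $\mathbb B$ is the closed unit ball centered at $\mathbf 0$. For a set $A$, $\mathrm B(A,r)=\{z:\ \mathrm{dist}(z,A)\le r\}$ is its $r$-enlargement. Local weak efficiency: $\bar x\in\mathcal R$ is a local weakly efficient solution to the problem of minimizing $f$ over $\mathcal R$ if there is $\delta>0$ with $f(\mathcal R\cap \mathrm B(\bar x,\delta))\cap[f(\bar x)-\mathrm{int}\,K]=\varnothing$. $f$ is $K$-Lipschitz near $\bar x$ with constant $\ell_f>0$ and vector $e\in\mathrm{int}\,K\cap\mathbb B$ if for some $\delta>0$: $f(x_1)\in f(x_2)-\ell_f\|x_1-x_2\|e+K$ for all $x_1,x_2\in \mathrm B(\bar x,\delta)$. $f'(\bar x;v)=\lim_{t\downarrow0}(f(\bar x+tv)-f(\bar x))/t$ is the directional derivative; $f$ is directionally differentiable at $\bar x$ if this exists for every $v\in\mathbb X$. $G$ is lower semicontinuous (l.s.c.) at $x$ if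 for every open $V$ with $V\cap G(x)\ne\varnothing$ there is a neighbourhood $U$ of $x$ with $G(u)\cap V\neq\varnothing$ for all $u\in U$. $G$ is metrically $C$-increasing around $\bar x$, relative to $S$, if there exist $\delta>0$ and $\alpha>1$ such that $$(\ast)\quad\forall x\in \mathrm B(\bar x,\delta)\cap S,\ \forall r\in(0,\delta)\ \ \exists z\in \mathrm B(x,r)\cap S:\ \ \mathrm B(G(z),\alpha r)\subseteq \mathrm B(G(x)+C,r).$$ $\mathrm{inc}_C(G;S;\bar x)=\sup\{\alpha>1:\ \exists\delta>0\text{ for which }(\ast)\text{ holds}\}$. Merit function: $\nu_{G,C}:\mathbb X\to[0,+\infty]$, $\nu_{G,C}(x)=\sup_{z\in G(x)}\mathrm{dist}(z,C)$. Fréchet upper subdifferential of $\varphi$ (finite around $\bar x$) at $\bar x$: $\widehat\partial^+\varphi(\bar x)=\{x^*\in\mathbb X^*:\ \limsup_{x\to\bar x}\frac{\varphi(x)-\varphi(\bar x)-\langle x^*,x-\bar x\rangle}{\|x-\bar x\|}\le0\}$. Feasible direction cone: $\mathrm I(S;\bar x)=\{v\in\mathbb X:\ \exists\delta>0:\ \bar x+tv\in S,\ \forall t\in(0,\delta)\}$. *)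

(* Defs.v *)
From HB Require Import structures.
From mathcomp Require Import all_boot all_order all_algebra.
From mathcomp Require Import all_classical all_reals all_analysis.

Set Implicit Arguments.
Unset Strict Implicit.
Unset Printing Implicit Defensive.

Import Order.TTheory GRing.Theory Num.Theory.
Import numFieldNormedType.Exports.

Local Open Scope classical_set_scope.
Local Open Scope ring_scope.

Section Distance.
Context {R : realType} {Z : normedModType R}.

(* [edist_inf A z], the distance from z to A, is extended-real-valued, with
   value +oo exactly when A is empty. The library defines it through
   pseudometric balls; in a normed space it is the usual distance. *)
Lemma edist_norm (x y : Z) : edist (x, y) = `|x - y|%:E.
Proof.
apply/eqP; rewrite eq_le; apply/andP; split.
  apply/lee_addgt0Pr => e e0; apply: edist_fin => /=.
    by rewrite ltr_wpDl.
  by rewrite -ball_normE /= ltrDl.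
apply: le_ereal_inf_tmp => _ [r [r0 xyr] <-].
by rewrite lee_fin ltW//; move: xyr; rewrite -ball_normE.
Qed.

Lemma edist_inf_norm (A : set Z) (z : Z) :
  edist_inf A z = ereal_inf [set `|z - a|%:E | a in A].
Proof. by congr ereal_inf; apply: eq_imagel => a _; exact: edist_norm. Qed.

Definition enlargement (A : set Z) (r : R) : set Z :=
  [set z | (edist_inf A z <= r%:E)%E].

End Distance.

(* The nonemptiness and the scaling by t = 0 put 0 in the cone. *)
Definition convex_cone {R : realType} {V : normedModType R} (K : set V) : Prop :=
  [/\ K !=set0,
      forall (t : R) (x : V), 0 <= t -> K x -> K (t *: x)
    & convex_set K].

Section Objective.
Context {R : realType} {X Y : normedModType R}.

Definition local_weakly_efficient (f : X -> Y) (K : set Y) (Q : set X)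
    (xbar : X) : Prop :=
  Q xbar /\
  exists2 delta : R, 0 < delta &
    (f @` (Q `&` closed_ball xbar delta)) `&` [set f xbar - k | k in K°]
      = set0.

Definition cone_lipschitz_near (f : X -> Y) (K : set Y) (xbar : X) (lf : R)
    (e : Y) : Prop :=
  [/\ 0 < lf, (K° `&` closed_ball 0 1) e &
   exists2 delta : R, 0 < delta &
     forall x1 x2, closed_ball xbar delta x1 -> closed_ball xbar delta x2 ->
       [set f x2 - (lf * `|x1 - x2|) *: e + k | k in K] (f x1)].

Definition dir_quotient (f : X -> Y) (xbar v : X) (t : R) : Y :=
  t^-1 *: (f (xbar + t *: v) - f xbar).

(* One-sided (t > 0), unlike the library's ['D_v f xbar]. *)
Definition dir_derivative (f : X -> Y) (xbar v : X) : Y :=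
  lim (dir_quotient f xbar v t @[t --> 0^'+]).

Definition dir_differentiable (f : X -> Y) (xbar : X) : Prop :=
  forall v : X, cvg (dir_quotient f xbar v t @[t --> 0^'+]).

Definition feasible_directions (S : set X) (xbar : X) : set X :=
  [set v | exists2 delta : R, 0 < delta &
     forall t : R, 0 < t < delta -> S (xbar + t *: v)].

(* Elements of the topological dual are the continuous linear maps into the
   scalars. *)
Definition frechet_upper_subdiff (phi : X -> \bar R) (xbar : X)
    : set {linear X -> R^o} :=
  [set xs : {linear X -> R^o} | [/\ continuous xs,
     \forall x \near xbar, phi x \is a fin_num
   & (limf_esup (fun x => (phi x - phi xbar - (xs (x - xbar))%:E)
                          * (`|x - xbar|^-1)%:E) xbar^' <= 0)%E]].

End Objective.

Section SetValued.
Context {R : realType} {X Z : normedModType R}.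

Definition set_lsc_at (G : X -> set Z) (x : X) : Prop :=
  forall V : set Z, open V -> V `&` G x !=set0 ->
    \forall u \near x, G u `&` V !=set0.

Definition cone_increasing_at_rate (G : X -> set Z) (C : set Z) (S : set X)
    (xbar : X) (alpha delta : R) : Prop :=
  forall x, (closed_ball xbar delta `&` S) x ->
  forall r : R, 0 < r < delta ->
  exists2 z, (closed_ball x r `&` S) z &
    enlargement (G z) (alpha * r) `<=`
    enlargement [set g + c | g in G x & c in C] r.

Definition metrically_increasing (G : X -> set Z) (C : set Z) (S : set X)
    (xbar : X) : Prop :=
  exists delta alpha : R,
    [/\ 0 < delta, 1 < alpha & cone_increasing_at_rate G C S xbar alpha delta].

Definition inc_bound (G : X -> set Z) (C : set Z) (S : set X) (xbar : X)
    : \bar R :=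
  ereal_sup [set alpha%:E | alpha in
    [set alpha : R | 1 < alpha /\
       exists2 delta : R, 0 < delta &
         cone_increasing_at_rate G C S xbar alpha delta]].

Definition merit (G : X -> set Z) (C : set Z) (x : X) : \bar R :=
  ereal_sup [set edist_inf C z | z in G x].

Definition feasible_region (G : X -> set Z) (C : set Z) (S : set X) : set X :=
  [set x | S x /\ G x `<=` C].

End SetValued.

(* Main.v *)
(* One application of the metric increase of G at x, with r = nu(x)/(alpha - 1),
   yields a point z of S within r of x such that the alpha r-balls around the
   points of G(z) stay within nu(x) + r = alpha r of C. A point outside the
   convex set C can be pushed away from C along a ray, gaining the full alpha r
   in distance; hence G(z) is contained in C, and x is within nu(x)/(alpha - 1)
   of the feasible region. By the K-Lipschitz property xbar is then locally
   weakly efficient over S for f + l/(alpha - 1) nu e, and an upper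
   subgradient bounds nu from above along the feasible rays. *)
Require Import Defs.
From HB Require Import structures.
From mathcomp Require Import all_boot all_order all_algebra.
From mathcomp Require Import all_classical all_reals all_analysis.
From mathcomp Require Import ring lra.

Set Implicit Arguments.
Unset Strict Implicit.
Unset Printing Implicit Defensive.

Import Order.TTheory GRing.Theory Num.Theory.
Import numFieldNormedType.Exports.

Local Open Scope classical_set_scope.
Local Open Scope ring_scope.

(** * Sums and interiors of convex cones *)

Section ConvexCone.
Context {R : realType} {V : normedModType R}.
Implicit Types (K : set V) (x y : V).

Lemma convex_set_conv K (t : R) x y : convex_set K -> 0 <= t <= 1 ->
  K x -> K y -> K (t *: x + (1 - t) *: y).
Proof.
move=> Kconv /andP[t0 t1] Kx Ky.
have := Kconv x y (Itv01 t0 t1); rewrite !inE; exact.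
Qed.

(** The sum is twice the midpoint. *)
Lemma convex_coneD K x y : convex_cone K -> K x -> K y -> K (x + y).
Proof.
move=> [_ Kscale Kconv] Kx Ky.
have half_itv : 0 <= (2^-1 : R) <= 1 by lra.
have := Kscale 2 _ (ler0n _ _) (convex_set_conv Kconv half_itv Kx Ky).
rewrite scalerDr !scalerA (_ : 2 * (1 - 2^-1) = 1 :> R); last by field.
by rewrite divff ?pnatr_eq0// !scale1r.
Qed.

(** Near [x + y], [w - y] lies in [K], and adding [y] back stays in [K]. *)
Lemma interior_coneD K x y : convex_cone K -> K° x -> K y -> K° (x + y).
Proof.
move=> Kcone Kx Ky; rewrite /interior /=.
have shift : (w - y) @[w --> (x + y : V)] --> x.
  rewrite -[X in _ --> X](addrK y).
  by apply: cvgB; [exact: cvg_id|exact: cvg_cst].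
apply: (@filterS _ (nbhs (x + y : V)) _ _ _ _ (shift _ Kx)) => w /= Kw.
by rewrite -(subrK y w); exact: convex_coneD.
Qed.

Lemma interior_coneZ K (t : R) x : convex_cone K -> 0 < t ->
  K° x -> K° (t *: x).
Proof.
move=> [_ Kscale _] t0 Kx; rewrite /interior /=.
have unscale : t^-1 *: w @[w --> (t *: x : V)] --> x.
  rewrite -[X in _ --> X](scalerK (lt0r_neq0 t0)).
  by apply: cvgZr; exact: cvg_id.
apply: (@filterS _ (nbhs (t *: x : V)) _ _ _ _ (unscale _ Kx)) => w /= Kw.
by rewrite -(scalerKV (lt0r_neq0 t0) w); exact: Kscale (ltW t0) Kw.
Qed.

End ConvexCone.

(** * Distance to a closed or convex set *)

Section Distance.
Context {R : realType} {Z : normedModType R}.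
Implicit Types (A C : set Z) (z c : Z).

(** The infimum need not be attained, so every use of a nearest point goes through an arbitrarily
    small slack. *)
Lemma le_edist_infP A z (r : R) : (edist_inf A z <= r%:E)%E <->
  forall eps, 0 < eps -> exists2 a, A a & `|z - a| < r + eps.
Proof.
rewrite edist_inf_norm; split=> [Azr eps eps0|Azr].
  have /ereal_inf_lt[_ [a Aa <-]] :
      (ereal_inf [set `|z - a|%:E | a in A] < (r + eps)%:E)%E.
    by apply: le_lt_trans Azr _; rewrite lte_fin ltrDl.
  by rewrite lte_fin => zar; exists a.
apply/lee_addgt0Pr => eps /Azr[a Aa zar].
apply: le_trans (_ : `|z - a|%:E <= _)%E.
  by apply: ereal_inf_lbound; exists a.
by rewrite -EFinD lee_fin ltW.
Qed.

Lemma closed_dist_gt0 C z : closed C -> ~ C z ->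
  exists2 d : R, 0 < d & forall c, C c -> d <= `|z - c|.
Proof.
move=> Ccl nCz.
have /nbhs_ballP[d /= d0 dC] : nbhs z (~` C).
  by apply: open_nbhs_nbhs; split; [exact: closed_openC|].
exists d => // c Cc; rewrite leNgt; apply/negP => zcd.
by apply: (dC c) => //; rewrite -ball_normE.
Qed.

(* Convexity of the distance to [C], along the ray issued from [c] through
   [z]. *)
Lemma convex_dist_ray C z c c' (d rho : R) : convex_set C -> C c -> C c' ->
  (forall a, C a -> d <= `|z - a|) -> 0 < `|z - c| -> 0 <= rho ->
  d * (`|z - c| + rho) <=
  `|z - c| * `|z + (rho / `|z - c|) *: (z - c) - c'|.
Proof.
move=> Cconv Cc Cc' dC; set s := `|z - c| => s0 rho0.
have s_rho : 0 < s + rho by lra.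
(* This weight makes [z] the convex combination of the ray point (weight [t]) and [c] (weight
   [1 - t]); the same combination of [c'] and [c] lies in [C]. *)
pose t := s / (s + rho).
have t01 : 0 <= t <= 1.
  by rewrite divr_ge0 ?(ltW s0) ?(ltW s_rho)//= ler_pdivrMr// mul1r lerDl.
rewrite -ler_pdivlMr// mulrAC -/t.
apply: le_trans (dC _ (convex_set_conv Cconv t01 Cc' Cc)) _.
have t_rho : t * (rho / s) = 1 - t by rewrite /t; field; lra.
rewrite -[X in X * _]ger0_norm; last by case/andP: t01.
rewrite -normrZ scalerBr scalerDr scalerA t_rho scalerBr.
suff -> : z - (t *: c' + (1 - t) *: c) =
  t *: z + ((1 - t) *: z - (1 - t) *: c) - t *: c' by [].
by rewrite addrA -scalerDl [t + _]addrC subrK scale1r opprD addrA addrAC.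
Qed.

End Distance.

(** * Error bound for the feasible region *)

Section ErrorBound.
Context {R : realType} {X Z : normedModType R}.
Implicit Types (G : X -> set Z) (C : set Z) (S : set X).

Lemma cone_increasing_at_rate_le G C S xbar (alpha beta delta : R) :
  alpha <= beta -> cone_increasing_at_rate G C S xbar beta delta ->
  cone_increasing_at_rate G C S xbar alpha delta.
Proof.
move=> ab Ginc x Sx r r0; have [z Sz Gz] := Ginc x Sx r r0.
exists z => // w Gw; apply: Gz; apply: le_trans Gw _.
by rewrite lee_fin ler_wpM2r//; case/andP: r0 => /ltW.
Qed.

(** Triangle inequality through [g + c]: if [c'] in [C] nearly realizes the distance of [g], then
    [c + c'] is again in [C]. *)
Lemma enlargement_cone_dist G C x (m r : R) w : convex_cone C ->
  (merit G C x <= m%:E)%E -> enlargement [set g + c | g in G x & c in C] r w ->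
  (edist_inf C w <= (m + r)%:E)%E.
Proof.
move=> Ccone Gxm /le_edist_infP wr; apply/le_edist_infP => eps eps0.
have eps2 : 0 < eps / 2 by lra.
have [_ [g Gg [c Cc <-]] wgc] := wr _ eps2.
have /le_edist_infP/(_ _ eps2)[c' Cc' gc'] : (edist_inf C g <= m%:E)%E.
  by apply: le_trans Gxm; apply: ereal_sup_ubound; exists g.
exists (c + c'); first exact: convex_coneD.
have -> : w - (c + c') = (w - (g + c)) + (g - c').
  by rewrite [g + c]addrC !opprD !addrA subrK.
by apply: le_lt_trans (ler_normD _ _) _; lra.
Qed.

Lemma merit_error_bound G C S xbar (alpha delta : R) x (m : R) :
  convex_cone C -> closed C -> 1 < alpha ->
  cone_increasing_at_rate G C S xbar alpha delta ->
  (closed_ball xbar delta `&` S) x -> (merit G C x <= m%:E)%E ->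
  0 < m -> m / (alpha - 1) < delta ->
  exists2 z, closed_ball x (m / (alpha - 1)) z & feasible_region G C S z.
Proof.
move=> Ccone Ccl alpha1 Ginc Sx Gxm m0; set r := m / (alpha - 1) => rdelta.
have alpha10 : 0 < alpha - 1 by lra.
have r0 : 0 < r by rewrite divr_gt0.
(* The choice of [r] balances the two radii: the enlargement of [G z] and the distance bound to [C]
   have the same size. *)
have m_r : m + r = alpha * r by rewrite /r; field; lra.
have [|z [xz Sz] Gz] := Ginc x Sx r; first by rewrite r0.
exists z => //; split => // g Gg; apply: contrapT => nCg.
have [d0 d0_gt0 d0C] := closed_dist_gt0 Ccl nCg.
have [[c0 Cc0] _ Cconv] := Ccone.
have dist_le c : C c -> (edist_inf C g <= `|g - c|%:E)%E.
  by move=> Cc; rewrite -edist_norm; apply: ereal_inf_lbound; exists c.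
have dist_fin : edist_inf C g \is a fin_num.
  rewrite ge0_fin_numE ?edist_inf_ge0//.
  exact: le_lt_trans (dist_le _ Cc0) (ltry _).
set d := fine (edist_inf C g).
have dC c : C c -> d <= `|g - c| by move/dist_le; rewrite -lee_fin fineK.
have d_approx eps : 0 < eps -> exists2 c, C c & `|g - c| < d + eps.
  by move: eps; apply/le_edist_infP; rewrite fineK.
have d_gt0 : 0 < d.
  rewrite ltNge; apply/negP => d_le0.
  by have [c /d0C] := d_approx _ d0_gt0; lra.
pose rho := alpha * r.
have rho0 : 0 < rho by rewrite mulr_gt0//; lra.
(* With an exact projection, the ray would give [d * (d + rho) <= d * rho]. An approximate one adds
   an error of at most [eps * (rho + 2 * d)], which this choice makes [d ^+ 2 / 2], still below
   [d ^+ 2]. *)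
pose eps := d * (d / (2 * (rho + 2 * d))).
have den0 : 0 < 2 * (rho + 2 * d) by lra.
have eps0 : 0 < eps by rewrite mulr_gt0// divr_gt0.
have eps_le : eps <= d.
  by rewrite /eps ger_pMr// ler_pdivrMr//; lra.
have epsE : eps * (rho + 2 * d) = d ^+ 2 / 2 by rewrite /eps; field; lra.
have [c Cc gc] := d_approx _ eps0.
have s_d := dC _ Cc; have s0 : 0 < `|g - c| by lra.
(* [w] lies at distance exactly [rho] from [g], on the ray leaving [c] through [g]. *)
pose w := g + (rho / `|g - c|) *: (g - c).
have Gw : enlargement (G z) rho w.
  apply/le_edist_infP => eta eta0; exists g => //.
  rewrite /w addrC addKr normrZ ger0_norm ?divr_ge0 ?ltW//.
  by rewrite divfK ?gt_eqF// ltrDl.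
have /le_edist_infP/(_ _ eps0)[c' Cc' wc'] :
  (edist_inf C w <= (m + r)%:E)%E by apply: enlargement_cone_dist Gxm (Gz _ Gw).
have := convex_dist_ray Cconv Cc Cc' dC s0 (ltW rho0).
rewrite -/w => ray; move: wc'; rewrite m_r -/rho => /ltW wc'.
have {}ray : d * (`|g - c| + rho) <= `|g - c| * (rho + eps).
  by apply: le_trans ray _; rewrite ler_wpM2l// ltW.
have d_sq : d * d <= d * `|g - c| by rewrite ler_wpM2l ?(ltW d_gt0).
have s_rho : `|g - c| * (rho + eps) <= (d + eps) * (rho + eps).
  by rewrite ler_wpM2r ?ltW// addr_gt0.
have eps_sq : eps * eps <= eps * d by rewrite ler_wpM2l ?(ltW eps0).
nra.
Qed.

End ErrorBound.

(** * Exact penalization and upper subgradients *)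

Section Objective.
Context {R : realType} {X Y : normedModType R}.

(** The Lipschitz property puts [f z] below [f x + c *: e] in the order of [K], so a penalized
    improvement at [x] would be a true improvement at the feasible point [z]. *)
Lemma local_weakly_efficient_penalized (f : X -> Y) (K : set Y) (Q : set X)
    (xbar : X) (lf : R) (e : Y) :
  convex_cone K -> local_weakly_efficient f K Q xbar ->
  cone_lipschitz_near f K xbar lf e ->
  exists2 rho : R, 0 < rho & forall x z (c : R),
    `|xbar - x| <= rho -> `|xbar - z| <= rho -> Q z -> lf * `|x - z| <= c ->
    ~ K° (- (f x - f xbar + c *: e)).
Proof.
move=> Kcone [_ [d1 d10 eff]] [_ [Ke _] [d2 d20 lip]].
have [_ Kscale _] := Kcone.
exists (Num.min d1 d2); first by rewrite lt_min d10.
move=> x z c; rewrite !le_min => /andP[_ xd2] /andP[zd1 zd2] Qz lfc Kxc.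
have [||k Kk fx] := lip x z; try by rewrite closed_ballE.
suff Kz : K° (f xbar - f z).
  rewrite -[False]/(set0 (f z)) -eff; split.
    by exists z => //; split => //; rewrite closed_ballE.
  by exists (f xbar - f z) => //; rewrite subKr.
have Kslack : K ((c - lf * `|x - z|) *: e + k).
  apply: convex_coneD => //; apply: Kscale; first by rewrite subr_ge0.
  exact: interior_subset Ke.
have := interior_coneD Kcone Kxc Kslack; congr (K° _).
have -> : f z = f x + (lf * `|x - z|) *: e - k.
  by rewrite -fx addrAC addrK subrK.
by rewrite scalerBl !opprD !opprK !addrA addrNK [- f x + _]addrC.
Qed.

Lemma frechet_upper_subdiff_near (phi : X -> \bar R) xbar xs (eps : R) :
  frechet_upper_subdiff phi xbar xs -> phi xbar = 0%E -> 0 < eps ->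
  \forall x \near xbar, (phi x <= (xs (x - xbar) + eps * `|x - xbar|)%:E)%E.
Proof.
move=> [_ phi_fin limsup] phi0 eps0.
have /ereal_inf_lt[_ [V Vxbar <-] Veps] :
    (limf_esup (fun x => (phi x - phi xbar - (xs (x - xbar))%:E)
                         * (`|x - xbar|^-1)%:E) xbar^' < eps%:E)%E.
  by apply: le_lt_trans limsup _; rewrite lte_fin.
have {}Vxbar : \forall x \near xbar, x != xbar -> V x by exact: Vxbar.
apply: filterS2 phi_fin Vxbar => x phix Vx.
(* The upper limit ignores [xbar] itself, where both sides vanish. *)
have [->|xxbar] := eqVneq x xbar.
  by rewrite phi0 subrr linear0 normr0 mulr0 addr0.
have x0 : 0 < `|x - xbar| by rewrite normr_gt0 subr_eq0.
have {Vx} : ((phi x - phi xbar - (xs (x - xbar))%:E)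
             * (`|x - xbar|^-1)%:E < eps%:E)%E.
  apply: le_lt_trans Veps; apply: ereal_sup_ubound.
  by exists x => //; exact: Vx.
rewrite phi0 -(fineK phix) sube0 -EFinB -EFinM lte_fin lee_fin.
by rewrite ltr_pdivrMr// => /ltW; rewrite lerBlDl.
Qed.

End Objective.

(** * Sign and zeros of the merit function *)

Section Merit.
Context {R : realType} {X Z : normedModType R}.
Implicit Types (G : X -> set Z) (C : set Z).

Lemma merit_ge0 G C x : G x !=set0 -> (0 <= merit G C x)%E.
Proof.
move=> [g Gg]; apply: le_trans (edist_inf_ge0 C g) _.
by apply: ereal_sup_ubound; exists g.
Qed.

Lemma merit_eq0 G C x : G x !=set0 -> G x `<=` C -> merit G C x = 0%E.
Proof.
move=> Gx0 GC; apply/le_anti; rewrite merit_ge0// andbT.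
apply: ge_ereal_sup => _ [g /GC Cg <-].
by rewrite edist_inf0.
Qed.

End Merit.

(** * The optimality condition along feasible rays *)

Lemma cvg_at_right_ray {R : realType} {V : normedModType R} (x v : V) :
  x + t *: v @[t --> (0 : R)^'+] --> x.
Proof.
apply: cvg_at_right_filter.
rewrite -[X in _ --> X]addr0 -[X in _ --> _ + X](scale0r v).
by apply: cvgD; [exact: cvg_cst|apply: cvgZl; exact: cvg_id].
Qed.

Theorem theorem3p8 (R : realType) (X Y Z : completeNormedModType R)
  (K : set Y) (C : set Z) (S : set X) (f : X -> Y) (G : X -> set Z)
  (xbar : X) (lf : R) (e : Y)
  (K_cone : convex_cone K) (K_proper : K <> setT) (K_int : K° !=set0)
  (C_cone : convex_cone C) (C_closed : closed C)
  (C_proper : C <> setT) (C_neq0 : C <> [set 0])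
  (S_neq0 : S !=set0) (S_closed : closed S)
  (G_neq0 : forall x, G x !=set0)
  (xbar_eff : local_weakly_efficient f K (feasible_region G C S) xbar)
  (f_lip : cone_lipschitz_near f K xbar lf e)
  (f_dir : dir_differentiable f xbar)
  (G_lsc : \forall x \near xbar, set_lsc_at G x)
  (G_inc : metrically_increasing G C S xbar)
  (nu_subdiff : frechet_upper_subdiff (merit G C) xbar !=set0) :
  forall alpha : R, 1 < alpha -> (alpha%:E < inc_bound G C S xbar)%E ->
  forall l : R, lf <= l ->
  forall xs : {linear X -> R^o}, frechet_upper_subdiff (merit G C) xbar xs ->
  forall v : X, feasible_directions S xbar v ->
    ~ [set - k | k in K°]
        (dir_derivative f xbar v + (l / (alpha - 1) * xs v) *: e).
Proof.
move=> alpha alpha1 /ereal_sup_gt[_ [beta [_ [delta delta0 Gbeta]] <-]].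
rewrite lte_fin => /ltW alpha_beta l lf_l xs xs_sub v [tau tau0 Sv] [p Kp pE].
have alpha10 : 0 < alpha - 1 by rewrite subr_gt0.
have Ginc := cone_increasing_at_rate_le alpha_beta Gbeta.
have [rho rho0 not_better] :=
  local_weakly_efficient_penalized K_cone xbar_eff f_lip.
have [[_ GC] _] := xbar_eff; have merit0 := merit_eq0 (G_neq0 xbar) GC.
(* [slope eps] is a strict upper bound of the growth rate of the merit function
   along [v], so that the merit is bounded by a positive number. *)
pose slope (eps : R) : R := xs v + eps * (`|v| + 1).
pose kappa (eps : R) : R := l / (alpha - 1) * slope eps.
(* As [eps] decreases to 0, [kappa eps] tends to the coefficient in the conclusion; openness of the
   interior of [K] leaves room for some positive [eps]. *)
have [eps [eps0 Keps]] : exists eps : R, 0 < eps /\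
    K° (- (dir_derivative f xbar v + kappa eps *: e)).
  have kappa_cvg : - (dir_derivative f xbar v + kappa eps *: e)
      @[eps --> (0 : R)^'+] --> p.
    apply: cvg_at_right_filter.
    rewrite -[X in _ --> X]opprK pE; apply: cvgN; apply: cvgD.
      exact: cvg_cst.
    apply: cvgZl; apply: cvgMr.
    rewrite -[X in _ --> X]addr0 -[X in _ --> _ + X](mul0r (`|v| + 1)).
    by apply: cvgD; [exact: cvg_cst|apply: cvgMl; exact: cvg_id].
  have Kopen : nbhs p K°.
    by apply: open_nbhs_nbhs; split => //; exact: open_interior.
  suff : \forall eps \near (0 : R)^'+, 0 < eps /\
      K° (- (dir_derivative f xbar v + kappa eps *: e)).
    exact: filter_ex.
  near=> eps; split; near: eps; [exact: nbhs_right_gt|exact: kappa_cvg _ Kopen].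
have small B (eta : R) : 0 < eta -> \forall t \near (0 : R)^'+, t * B < eta.
  move=> eta0; have : t * B @[t --> (0 : R)^'+] --> 0.
    apply: cvg_at_right_filter; rewrite -[X in _ --> X](mul0r B).
    by apply: cvgMl; exact: cvg_id.
  by move/cvgr_lt; apply.
have quot_near : \forall t \near (0 : R)^'+,
    K° (- (dir_quotient f xbar v t + kappa eps *: e)).
  have quot_cvg : - (dir_quotient f xbar v t + kappa eps *: e)
      @[t --> (0 : R)^'+] --> - (dir_derivative f xbar v + kappa eps *: e).
    by apply: cvgN; apply: cvgD; [exact: f_dir|exact: cvg_cst].
  apply: (quot_cvg K°).
  by apply: open_nbhs_nbhs; split => //; exact: open_interior.
have merit_near :=
  @cvg_at_right_ray _ _ xbar v _ (frechet_upper_subdiff_near xs_sub merit0 eps0).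
near (0 : R)^'+ => t.
have t0 : 0 < t by near: t; exact: nbhs_right_gt.
have t_tau : t < tau by near: t; exact: nbhs_right_lt.
pose x := xbar + t *: v; pose m := t * slope eps; pose r := m / (alpha - 1).
have Sx : S x by apply: Sv; rewrite t0.
have x_xbar : `|xbar - x| = t * `|v|.
  by rewrite /x opprD addrA subrr sub0r normrN normrZ gtr0_norm.
have merit_lt : (merit G C x < m%:E)%E.
  apply: (@le_lt_trans _ _ (t * (xs v + eps * `|v|))%:E); last first.
    by rewrite lte_fin ltr_pM2l// ltrD2l ltr_pM2l// ltrDl.
  have : (merit G C x <= (xs (x - xbar) + eps * `|x - xbar|)%:E)%E.
    by rewrite /x; near: t; exact: merit_near.
  rewrite distrC x_xbar /x addrAC subrr add0r linearZ.
  by rewrite mulrDr [t * (eps * _)]mulrCA.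
(* The strict bound keeps [m] positive even where the merit vanishes, as the error bound demands. *)
have m0 : 0 < m by rewrite -lte_fin (le_lt_trans _ merit_lt)// merit_ge0.
have r_delta : r < delta.
  by rewrite /r /m -mulrA; near: t; exact: small.
have [|z xz Qz] := merit_error_bound C_cone C_closed alpha1 Ginc (x := x)
    _ (ltW merit_lt) m0 r_delta.
  split => //; rewrite closed_ballE//= /closed_ball_ /= x_xbar ltW//.
  by near: t; exact: small.
have r0 : 0 < r by rewrite divr_gt0.
have {}xz : `|x - z| <= r by move: xz; rewrite closed_ballE.
(* The penalty [t * kappa eps] equals [l * r], which dominates the Lipschitz cost of moving from [x]
   to [z]. *)
apply: (not_better x z (t * kappa eps)) => //.
- by rewrite x_xbar ltW//; near: t; exact: small.
- rewrite -(subrKA x); apply: le_trans (ler_normD _ _) _.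
  apply: le_trans (_ : t * (`|v| + slope eps / (alpha - 1)) <= _).
    by rewrite x_xbar mulrDr lerD2l mulrA.
  by rewrite ltW//; near: t; exact: small.
- have -> : t * kappa eps = l * r by rewrite /kappa /r /m; ring.
  by have [lf0 _ _] := f_lip; apply: ler_pM => //; exact: ltW.
(* Scaling by [t] turns the difference quotient back into [f x - f xbar]. *)
have : K° (t *: - (dir_quotient f xbar v t + kappa eps *: e)).
  by apply: interior_coneZ => //; near: t; exact: quot_near.
by rewrite scalerN scalerDr scalerA /dir_quotient scalerA divff ?gt_eqF// scale1r.
Unshelve. all: by end_near. Qed.
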